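(* Let $h_1,h_2\in\mathbb{C}$, $q=e^{h_1}$, $p=e^{h_2}$, $pq\neq\pm1$, $h=\frac{h_1+h_2}{2}=\frac12\ln(pq)$. Let $T=\begin{pmatrix} a&\beta\\ \gamma&d\end{pmatrix}\in GL_{p,q}(1|1)$ with $T=e^{hM}$, where $M=\begin{pmatrix} x&\mu\\ \nu&y\end{pmatrix}\in\mathcal{M}_{h_1,h_2}$. Then $$sD_{p,q}(T)=e^{h(x-y)}=e^{h\,\mathrm{str}M}.$$
   Context: All entries lie in a unital associative $\mathbb{C}$-algebra in which the exponential series involved make sense; $[u,v]=uv-vu$. $T\in GL_{p,q}(1|1)$ means $a\beta=q\beta a$, $d\beta=q\beta d$, $a\gamma=p\gamma a$, $d\gamma=p\gamma d$, $\beta\gamma+pq^{-1}\gamma\beta=0$, $\beta^2=0=\gamma^2$, $ad-da=(p-q^{-1})\gamma\beta$, with $a$ and $d$ assumed invertible. $M\in\mathcal{M}_{h_1,h_2}$ means $$[x,\mu]=\tfrac{h_1}{h}\mu,\quad [y,\mu]=\tfrac{h_1}{h}\mu,\quad \mu^2=0,\quad [x,\nu]=\tfrac{h_2}{h}\nu,\quad [y,\nu]=\tfrac{h_2}{h}\nu,\quad \nu^2=0,\quad xy-yx=0,\quad \mu\nu+\nu\mu=0.$$ The quantum superdeterminant is $sD_{p,q}(T)=ad^{-1}-\beta d^{-1}\gamma d^{-1}$, and the supertrace is $\mathrm{str}M=x-y$. *)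

(* Defs.v *)
From HB Require Import structures.
From mathcomp Require Import all_boot all_order all_algebra.
From mathcomp Require Import complex.
From mathcomp Require Import all_classical all_reals all_analysis.

Set Implicit Arguments.
Unset Strict Implicit.
Unset Printing Implicit Defensive.

Import Order.TTheory GRing.Theory Num.Theory.
Import numFieldNormedType.Exports.

Local Open Scope classical_set_scope.
Local Open Scope complex_scope.
Local Open Scope ring_scope.

Definition expC (R : realType) (z : R[i]) : R[i] :=
  (expR (complex.Re z) * cos (complex.Im z)) +i*
  (expR (complex.Re z) * sin (complex.Im z)).

(* [N] is a family of seminorms on [A] defining a Hausdorff locally convex
   topology for which the product is jointly continuous. The family need not be
   directed, whence the finite sums in the last clause. No completeness is
   required. Banach algebras and locally m-convex algebras are special cases. *)
Definition locally_convex_algebra (R : realType) (A : unitAlgType R[i])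
    (I : Type) (N : I -> A -> R) : Prop :=
  [/\ forall i (u v : A), N i (u + v) <= N i u + N i v,
      forall i (c : R[i]) (u : A), N i (c *: u) = Normc.normc c * N i u,
      forall u : A, (forall i, N i u = 0) -> u = 0
    & forall i, exists (J : seq I) (K : R), forall u v : A,
        N i (u * v) <= K * (\sum_(j <- J) N j u) * (\sum_(j <- J) N j v)].

(* The series [\sum_n u n] converges absolutely, and its sum is [s]. *)
Definition is_asum (R : realType) (A : unitAlgType R[i]) (I : Type)
    (N : I -> A -> R) (u : nat -> A) (s : A) : Prop :=
  forall i, cvgn (series (fun n => N i (u n))) /\
    (N i (\sum_(0 <= k < n) u k - s) @[n --> \oo] --> (0 : R)).

Definition asummable (R : realType) (A : unitAlgType R[i]) (I : Type)
    (N : I -> A -> R) (u : nat -> A) : Prop :=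
  exists s : A, is_asum N u s.

(* Meaningful only if [asummable N u]; the sum is then unique because the
   seminorms separate points. *)
Definition asum (R : realType) (A : unitAlgType R[i]) (I : Type)
    (N : I -> A -> R) (u : nat -> A) : A :=
  xget 0 [set s | is_asum N u s].

Definition exp_term (R : realType) (A : unitAlgType R[i]) (z : A) (n : nat) : A :=
  (n`!%:R^-1 : R[i]) *: z ^+ n.

Definition exp_defined (R : realType) (A : unitAlgType R[i]) (I : Type)
    (N : I -> A -> R) (z : A) : Prop :=
  asummable N (exp_term z).

Definition expA (R : realType) (A : unitAlgType R[i]) (I : Type)
    (N : I -> A -> R) (z : A) : A :=
  asum N (exp_term z).

(* 'M[A]_2 is an A-module, not an R[i]-module, in the library. *)
Definition cscalemx (R : realType) (A : unitAlgType R[i]) (c : R[i])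
    (Z : 'M[A]_2) : 'M[A]_2 :=
  \matrix_(i, j) (c *: Z i j).

Definition mexp_term (R : realType) (A : unitAlgType R[i]) (Z : 'M[A]_2)
    (n : nat) : 'M[A]_2 :=
  cscalemx (n`!%:R^-1) (Z ^+ n).

Definition mexp_defined (R : realType) (A : unitAlgType R[i]) (I : Type)
    (N : I -> A -> R) (Z : 'M[A]_2) : Prop :=
  forall i j, asummable N (fun n => mexp_term Z n i j).

Definition mexp (R : realType) (A : unitAlgType R[i]) (I : Type)
    (N : I -> A -> R) (Z : 'M[A]_2) : 'M[A]_2 :=
  \matrix_(i, j) asum N (fun n => mexp_term Z n i j).

Definition bracket (A : nzRingType) (u v : A) : A := u * v - v * u.

Definition GLpq (R : realType) (A : unitAlgType R[i]) (p q : R[i])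
    (T : 'M[A]_2) : Prop :=
  let a := T 0 0 in let beta := T 0 1 in
  let gamma := T 1 0 in let d := T 1 1 in
  [/\ a \is a GRing.unit /\ d \is a GRing.unit,
      a * beta = q *: (beta * a) /\ d * beta = q *: (beta * d),
      a * gamma = p *: (gamma * a) /\ d * gamma = p *: (gamma * d),
      [/\ beta * gamma + (p * q^-1) *: (gamma * beta) = 0,
          beta ^+ 2 = 0 & gamma ^+ 2 = 0]
    & a * d - d * a = (p - q^-1) *: (gamma * beta)].

Definition calM (R : realType) (A : unitAlgType R[i]) (h h1 h2 : R[i])
    (M : 'M[A]_2) : Prop :=
  let x := M 0 0 in let mu := M 0 1 in
  let nu := M 1 0 in let y := M 1 1 in
  [/\ [/\ bracket x mu = (h1 / h) *: mu, bracket y mu = (h1 / h) *: mu & mu ^+ 2 = 0],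
      [/\ bracket x nu = (h2 / h) *: nu, bracket y nu = (h2 / h) *: nu & nu ^+ 2 = 0],
      x * y - y * x = 0
    & mu * nu + nu * mu = 0].

Definition sD (R : realType) (A : unitAlgType R[i]) (T : 'M[A]_2) : A :=
  let a := T 0 0 in let beta := T 0 1 in
  let gamma := T 1 0 in let d := T 1 1 in
  a * d^-1 - beta * d^-1 * gamma * d^-1.

Definition str (R : realType) (A : unitAlgType R[i]) (M : 'M[A]_2) : A :=
  M 0 0 - M 1 1.

(* Main.v *)
Require Import Defs.
From HB Require Import structures.
From mathcomp Require Import all_boot all_order all_algebra.
From mathcomp Require Import complex zify.
From mathcomp Require Import all_classical all_reals all_analysis.

Set Implicit Arguments.
Unset Strict Implicit.
Unset Printing Implicit Defensive.

Import Order.TTheory GRing.Theory Num.Theory.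
Import numFieldNormedType.Exports.

Local Open Scope classical_set_scope.
Local Open Scope complex_scope.
Local Open Scope ring_scope.

(** Write [Z = h M] with entries [x, m, n, y] and [u = x - y], which commutes
    with all of them. In the ring of formal power series [A[[t]]] the equation
    [T' = Z T] is solved explicitly by
    [e^{ty} (e^{tu} + mn A1 | m B1 || n C1 | 1 - mn D1)], where the coefficients
    of [A1, B1, C1, D1] commute with each other, which gives the formal identity
    [e^{t h2} T00 T11 - T01 T10 = e^{t h2} e^{tu} T11^2]. Only the entries of
    [e^Z] and [e^u] are known to converge ([e^x] and [e^y] need not), and they
    are all that occurs in this identity: it can be evaluated at [t = 1] by
    Mertens' theorem on Cauchy products. Its left-hand side is then
    [p (sD T) T11^2] by the relations of [GLpq], and [T11] and [p] cancel. *)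

(** A separate name for [nat -> A], so that its product can be the Cauchy product instead of the
    pointwise one. *)
Definition pser (A : nzRingType) := nat -> A.

HB.instance Definition _ (A : nzRingType) :=
  GRing.Zmodule.copy (pser A) (nat -> A).

(** * Formal power series over a noncommutative ring *)

Section PserRing.
Variable A : nzRingType.
Implicit Types f g k : pser A.

Lemma pserP f g : (forall n, f n = g n) -> f = g.
Proof. by move=> fg; apply: funext. Qed.

Lemma pserD f g n : (f + g) n = f n + g n. Proof. by []. Qed.
Lemma pserN f n : (- f) n = - f n. Proof. by []. Qed.
Definition pconst (c : A) : pser A := fun n => if n is 0%N then c else 0.

Definition pmul f g : pser A := fun n => \sum_(i < n.+1) f i * g (n - i)%N.

(** A coefficient of a product involves only finitely many coefficients of the factors, so
    truncation carries ring identities over from [{poly A}]. *)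
Definition ptrunc n f : {poly A} := \poly_(i < n) f i.

Lemma coef_ptrunc n f i : (i < n)%N -> (ptrunc n f)`_i = f i.
Proof. by move=> lin; rewrite coef_poly lin. Qed.

Lemma coef_mul_ptrunc n f g i : (i < n)%N ->
  (ptrunc n f * ptrunc n g)`_i = pmul f g i.
Proof.
move=> lin; rewrite coefM; apply: eq_bigr => j _.
have le_ji : (j <= i)%N by rewrite -ltnS.
by rewrite !coef_ptrunc ?(leq_ltn_trans _ lin) ?leq_subr.
Qed.

Lemma pmulA : associative pmul.
Proof.
move=> f g k; apply: pserP => n.
transitivity (ptrunc n.+1 f * (ptrunc n.+1 g * ptrunc n.+1 k))`_n.
  rewrite coefM; apply: eq_bigr => j _.
  by rewrite coef_ptrunc // coef_mul_ptrunc // ltnS leq_subr.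
rewrite mulrA coefM; apply: eq_bigr => j _.
by rewrite coef_mul_ptrunc // coef_ptrunc // ltnS leq_subr.
Qed.

Lemma pmul1l : left_id (pconst 1) pmul.
Proof.
move=> f; apply: pserP => n; rewrite /pmul big_ord_recl /= mul1r subn0.
by rewrite big1 ?addr0 // => i _; rewrite mul0r.
Qed.

Lemma pmul1r : right_id (pconst 1) pmul.
Proof.
move=> f; apply: pserP => n; rewrite /pmul big_ord_recr /= subnn mulr1.
rewrite big1 ?add0r // => i _.
by rewrite -subnSK //= mulr0.
Qed.

Lemma pmulDl : left_distributive pmul +%R.
Proof.
move=> f g k; apply: pserP => n; rewrite pserD -big_split /=.
by apply: eq_bigr => i _; rewrite -mulrDl.
Qed.

Lemma pmulDr : right_distributive pmul +%R.
Proof.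
move=> f g k; apply: pserP => n; rewrite pserD -big_split /=.
by apply: eq_bigr => i _; rewrite -mulrDr.
Qed.

Lemma pone_neq0 : pconst 1 != 0.
Proof.
by apply/eqP => /(congr1 (fun f : pser A => f 0%N)) /eqP; rewrite oner_eq0.
Qed.

End PserRing.

HB.instance Definition _ (A : nzRingType) :=
  GRing.Zmodule_isNzRing.Build (pser A) (@pmulA A) (@pmul1l A) (@pmul1r A)
    (@pmulDl A) (@pmulDr A) (@pone_neq0 A).

Section PserTheory.
Variable A : nzRingType.
Implicit Types (f g : pser A) (c d : A).

Lemma pserM f g n : (f * g) n = \sum_(i < n.+1) f i * g (n - i)%N.
Proof. by []. Qed.

Lemma pserCM c f n : (pconst c * f) n = c * f n.
Proof.
rewrite pserM big_ord_recl /= subn0.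
by rewrite big1 ?addr0 // => i _; rewrite mul0r.
Qed.

Lemma pserM0 f g : (f * g) 0%N = f 0%N * g 0%N.
Proof. by rewrite pserM big_ord1 subnn. Qed.

Lemma pconst1 : pconst 1 = 1 :> pser A. Proof. by []. Qed.

Lemma pconstD c d : pconst (c + d) = pconst c + pconst d.
Proof. by apply: pserP => -[|n]; rewrite pserD //= addr0. Qed.

Lemma pconstN c : pconst (- c) = - pconst c.
Proof. by apply: pserP => -[|n]; rewrite pserN //= oppr0. Qed.

Lemma pconst0 : pconst 0 = 0 :> pser A.
Proof. by apply: pserP => -[|n]. Qed.

Lemma pconstM c d : pconst (c * d) = pconst c * pconst d.
Proof. by apply: pserP => -[|n]; rewrite pserCM //= mulr0. Qed.

Lemma pser_comm f g : (forall i j, GRing.comm (f i) (g j)) -> GRing.comm f g.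
Proof.
move=> fg; apply: pserP => n; rewrite !pserM (reindex_inj rev_ord_inj) /=.
apply: eq_bigr => i _; rewrite fg subSS subKn //.
by rewrite -ltnS.
Qed.

Definition pderiv f : pser A := fun n => f n.+1 *+ n.+1.

Lemma pderivD f g : pderiv (f + g) = pderiv f + pderiv g.
Proof. by apply: pserP => n; rewrite /pderiv pserD mulrnDl. Qed.

Lemma pderivN f : pderiv (- f) = - pderiv f.
Proof. by apply: pserP => n; rewrite /pderiv pserN mulNrn. Qed.

Lemma pderivC c : pderiv (pconst c) = 0.
Proof. by apply: pserP => n; rewrite /pderiv /= mul0rn. Qed.

Lemma coef_deriv_ptrunc n f i : (i.+1 < n)%N ->
  (ptrunc n f)^`()`_i = pderiv f i.
Proof. by move=> lin; rewrite coef_deriv coef_ptrunc. Qed.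

Lemma pderivM f g : pderiv (f * g) = pderiv f * g + f * pderiv g.
Proof.
apply: pserP => n; rewrite pserD.
(* The coefficient [n] of a derivative involves the coefficient [n.+1] of the product, hence the
   truncation at [n.+2]. *)
transitivity ((ptrunc n.+2 f * ptrunc n.+2 g)^`())`_n.
  by rewrite coef_deriv coef_mul_ptrunc.
rewrite derivM coefD !coefM; congr (_ + _); apply: eq_bigr => i _;
  rewrite coef_deriv_ptrunc ?coef_ptrunc ?ltnS ?leq_subr //.
- exact: leqW (leq_subr _ _).
- by rewrite -ltnS.
- exact: ltnW.
Qed.

End PserTheory.

(** * Formal exponentials and uniqueness for linear differential equations *)

Section PserExp.
Variables (F : numFieldType) (A : algType F).
Implicit Types (f g : pser A) (u v w z : A) (c : F).

(** The base field has characteristic zero, so [n.+1] can be divided out. *)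
Lemma mulrSn_inj n : injective (fun u : A => u *+ n.+1).
Proof.
move=> u v /= uv; rewrite -(scale1r u) -(scale1r v).
rewrite -(mulVf (_ : n.+1%:R != 0 :> F)) ?pnatr_eq0 //.
by rewrite -!scalerA !scaler_nat uv.
Qed.

Lemma pderiv_inj f g : f 0%N = g 0%N -> pderiv f = pderiv g -> f = g.
Proof.
move=> fg0 fg; apply: pserP => -[//|n].
by apply: (@mulrSn_inj n); rewrite -![_ *+ _]/(pderiv _ n) fg.
Qed.

(** The equation determines the coefficient [n.+1] from the coefficient [n]. *)
Lemma pderiv_linear_inj z f g : f 0%N = g 0%N ->
  pderiv f = pconst z * f -> pderiv g = pconst z * g -> f = g.
Proof.
move=> fg0 df dg; apply: pserP; elim=> [//|n fgn].
apply: (@mulrSn_inj n); rewrite -![_ *+ _]/(pderiv _ n) df dg.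
by rewrite !pserCM fgn.
Qed.

Definition pint f : pser A := fun n =>
  if n is m.+1 then (m.+1%:R^-1 : F) *: f m else 0.

Lemma pintK f : pderiv (pint f) = f.
Proof.
apply: pserP => n; rewrite /pderiv /= -scaler_nat scalerA.
by rewrite divff ?scale1r // pnatr_eq0.
Qed.

(** The series [e^{tz}] in a central variable [t]. *)
Definition pexp z : pser A := fun n => (n`!%:R^-1 : F) *: z ^+ n.

Lemma pexp0 z : pexp z 0%N = 1.
Proof. by rewrite /pexp fact0 invr1 scale1r. Qed.

Lemma factVS n : (n.+1`!%:R^-1 : F) *+ n.+1 = n`!%:R^-1.
Proof.
by rewrite -[LHS]mulr_natr factS natrM invfM mulrAC mulVf ?mul1r ?pnatr_eq0.
Qed.

Lemma pderiv_exp z : pderiv (pexp z) = pconst z * pexp z.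
Proof.
apply: pserP => n; rewrite pserCM /pderiv /pexp.
by rewrite scalerMnl factVS exprS scalerAr.
Qed.

Lemma comm_pexp w z : GRing.comm w z -> GRing.comm (pconst w) (pexp z).
Proof.
move=> wz; apply: pser_comm => -[|i] j /=; last exact: commr_sym (commr0 _).
by rewrite /GRing.comm /pexp -scalerAr -scalerAl commrX.
Qed.

(** The derivative of the product vanishes, because [pconst z] commutes with [pexp z]. *)
Lemma pexpNK z : pexp z * pexp (- z) = 1.
Proof.
apply: pderiv_inj; first by rewrite pserM0 !pexp0 mulr1.
rewrite pderivM !pderiv_exp -pconst1 pderivC pconstN mulNr mulrN !mulrA.
by rewrite comm_pexp // subrr.
Qed.

Lemma pexp_scalar_comm c f : GRing.comm (pexp c%:A) f.
Proof.
apply: pser_comm => i j; rewrite /GRing.comm /pexp -scalerAr -scalerAl.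
congr (_ *: _); apply/commr_sym/commrX.
by rewrite /GRing.comm mulr_algl mulr_algr.
Qed.

Lemma pconst_scalar_comm c f : GRing.comm (pconst c%:A) f.
Proof.
apply: pser_comm => -[|i] j /=; last exact: commr_sym (commr0 _).
by rewrite /GRing.comm mulr_algl mulr_algr.
Qed.

(* Both sides solve [F' = z F], since [z w = w (z + c)]. *)
Lemma pexp_shift z w c : z * w - w * z = c *: w ->
  pexp z * pconst w = pexp c%:A * (pconst w * pexp z).
Proof.
move=> zw; apply: (@pderiv_linear_inj z).
- by rewrite !pserM0 !pexp0 mulr1 mul1r.
- by rewrite pderivM pderiv_exp pderivC mulr0 addr0 mulrA.
rewrite !pderivM !pderiv_exp pderivC mul0r add0r.
rewrite (mulrA _ (pexp c%:A) _) -(pexp_scalar_comm c (pconst z)) -!mulrA.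
rewrite (mulrA (pconst c%:A)) -(pexp_scalar_comm c (pconst c%:A)) -!mulrA.
rewrite -mulrDr; congr (_ * _); rewrite !mulrA -mulrDl -!pconstM -pconstD.
by rewrite mulr_algl -zw subrK.
Qed.

(** [w] is an eigenvector of [bracket v] and of [bracket z] for the same eigenvalue, so the two
    contributions cancel. This makes [x - y] commute with the off-diagonal entries. *)
Lemma comm_sub_eigen v z w c : v * w - w * v = c *: w ->
  z * w - w * z = c *: w -> GRing.comm w (v - z).
Proof.
move=> vw zw; rewrite /GRing.comm mulrBr mulrBl -[v * w](subrK (w * v)) vw.
by rewrite -[z * w](subrK (w * z)) zw opprD addrACA subrr add0r.
Qed.

(* The double commutant of [u]: it contains [u], and its elements commute with
   each other and with everything that commutes with [u]. *)
Definition bicomm u v := forall w, GRing.comm w u -> GRing.comm w v.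

Definition pbicomm u f := forall n, bicomm u (f n).

Lemma bicomm_comm u v w : bicomm u v -> bicomm u w -> GRing.comm v w.
Proof. by move=> uv uw; apply/uw/commr_sym/uv. Qed.

Lemma pbicomm_comm u f g : pbicomm u f -> pbicomm u g -> GRing.comm f g.
Proof. by move=> uf ug; apply: pser_comm => i j; exact: bicomm_comm. Qed.

Lemma pbicomm_comm_const u w f : GRing.comm w u -> pbicomm u f ->
  GRing.comm (pconst w) f.
Proof.
move=> wu uf; apply: pser_comm => -[|i] j /=; last exact: commr_sym (commr0 _).
exact: uf.
Qed.

Lemma pbicommM u f g : pbicomm u f -> pbicomm u g -> pbicomm u (f * g).
Proof.
move=> uf ug n w wu; apply: commr_sum => i _.
by apply: commrM; [exact: uf|exact: ug].
Qed.

Lemma commrZ w v c : GRing.comm w v -> GRing.comm w (c *: v).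
Proof. by rewrite /GRing.comm -scalerAr -scalerAl => ->. Qed.

Lemma pbicomm_int u f : pbicomm u f -> pbicomm u (pint f).
Proof.
move=> uf [|n] w wu /=; first exact: commr0.
by apply: commrZ; exact: uf.
Qed.

Lemma pbicomm_exp u z : bicomm u z -> pbicomm u (pexp z).
Proof. by move=> uz n w wu; apply/commrZ/commrX/uz. Qed.

Lemma bicomm_scalar u c : bicomm u c%:A.
Proof. by move=> w _; rewrite /GRing.comm mulr_algl mulr_algr. Qed.

Lemma bicommN u v : bicomm u v -> bicomm u (- v).
Proof. by move=> uv w wu; apply/commrN/uv. Qed.

Lemma bicomm_id u : bicomm u u. Proof. by []. Qed.

(** Again each coefficient is determined by the preceding ones. A pair [(f, g)] stands for one
    column of a matrix solution. *)
Lemma pderiv_system_inj x m n y (f1 g1 f2 g2 : pser A) :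
  f1 0%N = f2 0%N -> g1 0%N = g2 0%N ->
  pderiv f1 = pconst x * f1 + pconst m * g1 ->
  pderiv g1 = pconst n * f1 + pconst y * g1 ->
  pderiv f2 = pconst x * f2 + pconst m * g2 ->
  pderiv g2 = pconst n * f2 + pconst y * g2 ->
  f1 = f2 /\ g1 = g2.
Proof.
move=> f0 g0 df1 dg1 df2 dg2.
suff fg k : f1 k = f2 k /\ g1 k = g2 k.
  by split; apply: pserP => k; case: (fg k).
elim: k => [//|k [fk gk]]; split; apply: (@mulrSn_inj k).
  by rewrite -![_ *+ _]/(pderiv _ k) df1 df2 !pserD !pserCM fk gk.
by rewrite -![_ *+ _]/(pderiv _ k) dg1 dg2 !pserD !pserCM fk gk.
Qed.

End PserExp.

(** * The formal superdeterminant identity *)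

Section FormalSdet.
Variables (F : numFieldType) (A : algType F).
Variables (x y m n : A) (h1 h2 : F).
Implicit Types (f g : pser A).
Hypothesis xm : x * m - m * x = h1 *: m.
Hypothesis ym : y * m - m * y = h1 *: m.
Hypothesis xn : x * n - n * x = h2 *: n.
Hypothesis yn : y * n - n * y = h2 *: n.
Hypothesis xy : x * y - y * x = 0.
Hypothesis mm : m * m = 0.
Hypothesis nn : n * n = 0.
Hypothesis mn : m * n + n * m = 0.

Let u := x - y.
Let cx : pser A := pconst x.
Let cy : pser A := pconst y.
Let cm : pser A := pconst m.
Let cn : pser A := pconst n.
Let cu : pser A := pconst u.
Let ey : pser A := pexp y.
Let eu : pser A := pexp u.
(** [em1] and [em2] are the central factors that appear when [cm] and [cn] are moved to the right
    past [ey]. *)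
Let em1 : pser A := pexp (- h1)%:A.
Let em2 : pser A := pexp (- h2)%:A.

(* Substituting the matrix [a, b; c, d] below into [T' = Z T] leaves these
   equations for [B1], [C1], [D1] and the equation [dA1], solved by [A1E]. *)
Variables B1 C1 D1 A1 : pser A.
Hypothesis biB : pbicomm u B1.
Hypothesis biC : pbicomm u C1.
Hypothesis dB1 : pderiv B1 = cu * B1 + em1.
Hypothesis dC1 : pderiv C1 = em2 * eu.
Hypothesis dD1 : pderiv D1 = em2 * B1.
Hypothesis B10 : B1 0%N = 0.
Hypothesis C10 : C1 0%N = 0.
Hypothesis D10 : D1 0%N = 0.
Hypothesis A1E : A1 = B1 * C1 - eu * D1.

(** Since [m] and [n] anticommute and square to zero, the only words in them are [1], [m], [n] and
    [m n] up to sign; the even ones occur on the diagonal, the odd ones off it. *)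
Let a := ey * (eu + cm * cn * A1).
Let b := ey * cm * B1.
Let c := ey * cn * C1.
Let d := ey * (1 - cm * cn * D1).

Let comm_mu : GRing.comm m u. Proof. exact: comm_sub_eigen xm ym. Qed.
Let comm_nu : GRing.comm n u. Proof. exact: comm_sub_eigen xn yn. Qed.
Let comm_yu : GRing.comm y u.
Proof.
by rewrite /GRing.comm /u mulrBr mulrBl (subr0_eq xy).
Qed.

Let biE : pbicomm u eu. Proof. exact/pbicomm_exp/bicomm_id. Qed.
Let em1K : em1 * pexp h1%:A = 1.
Proof. by rewrite -(pexp_scalar_comm h1) /em1 scaleNr pexpNK. Qed.
Let em2K : em2 * pexp h2%:A = 1.
Proof. by rewrite -(pexp_scalar_comm h2) /em2 scaleNr pexpNK. Qed.
Let em1CA f g : f * (em1 * g) = em1 * (f * g).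
Proof. by rewrite !mulrA (pexp_scalar_comm _ f). Qed.
Let em2CA f g : f * (em2 * g) = em2 * (f * g).
Proof. by rewrite !mulrA (pexp_scalar_comm _ f). Qed.

Let BE : GRing.comm B1 eu. Proof. exact: pbicomm_comm biB biE. Qed.

(** In the Leibniz expansion the two terms containing [em2], [B1] and [eu] cancel, because [B1] and
    [eu] commute. *)
Let dA1 : pderiv A1 = cu * A1 + em1 * C1.
Proof.
rewrite A1E pderivD pderivN (pderivM B1 C1) (pderivM eu D1) dB1 dC1 dD1.
rewrite pderiv_exp -/cu -/eu !(em2CA _ _) BE mulrDl mulrBr -!mulrA.
by rewrite opprD addrACA subrr addr0 addrAC.
Qed.

(** The trailing factor [f] in this rule and the next ones lets them rewrite inside right-nested
    products. *)
Let m_ey f : cm * (ey * f) = em1 * (ey * (cm * f)).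
Proof.
by rewrite [ey * (_ * _)]mulrA (pexp_shift ym) -/cm -/ey !mulrA em1K mul1r.
Qed.

Let n_ey f : cn * (ey * f) = em2 * (ey * (cn * f)).
Proof.
by rewrite [ey * (_ * _)]mulrA (pexp_shift yn) -/cn -/ey !mulrA em2K mul1r.
Qed.

Let u_ey f : cu * (ey * f) = ey * (cu * f).
Proof. by rewrite !mulrA (comm_pexp (commr_sym comm_yu)). Qed.

Let u_m f : cu * (cm * f) = cm * (cu * f).
Proof. by rewrite !mulrA -!pconstM comm_mu. Qed.

Let u_n f : cu * (cn * f) = cn * (cu * f).
Proof. by rewrite !mulrA -!pconstM comm_nu. Qed.

Let m_m f : cm * (cm * f) = 0.
Proof. by rewrite mulrA -pconstM mm pconst0 mul0r. Qed.

Let n_n f : cn * (cn * f) = 0.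
Proof. by rewrite mulrA -pconstM nn pconst0 mul0r. Qed.

Let n_m f : cn * (cm * f) = - (cm * (cn * f)).
Proof.
rewrite !mulrA -!pconstM -mulNr -pconstN; congr (pconst _ * _).
by apply/eqP; rewrite -addr_eq0 addrC mn.
Qed.

Let cxE : cx = cy + cu. Proof. by rewrite -pconstD /u addrC subrK. Qed.

Let dey : pderiv ey = cy * ey. Proof. exact: pderiv_exp. Qed.
Let deu : pderiv eu = cu * eu. Proof. exact: pderiv_exp. Qed.

Let da : pderiv a = cx * a + cm * c.
Proof.
rewrite /a /c (pderivM ey) pderivD !(pderivM (_ * _)) (pderivM cm) !pderivC.
rewrite dey deu dA1 mulr0 mul0r addr0 mul0r add0r cxE.
rewrite (mulrDl cy) -!mulrA -addrA.
(* With [x = y + u], the [cy] terms match those from the derivative of [ey]. In the rest, [ey] is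
   moved to the front and cancelled. *)
congr (_ + _); rewrite u_ey m_ey -em1CA -mulrDr; congr (_ * _).
by rewrite !mulrDr u_m u_n !em1CA addrA.
Qed.

Let dc : pderiv c = cn * a + cy * c.
Proof.
rewrite /a /c (pderivM (ey * cn)) (pderivM ey) pderivC dey dC1 mulr0 addr0.
rewrite -!mulrA n_ey mulrDr n_m n_n.
by rewrite !em2CA mulr0 oppr0 addr0 addrC.
Qed.

Let db : pderiv b = cx * b + cm * d.
Proof.
rewrite /b /d (pderivM (ey * cm)) (pderivM ey) pderivC dey dB1 mulr0 addr0.
rewrite cxE (mulrDl cy) -!mulrA -addrA; congr (_ + _).
rewrite u_ey u_m m_ey mulrBr mulr1 m_m subr0 !mulrDr.
by congr (_ + _); rewrite -(pexp_scalar_comm _ cm) em1CA.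
Qed.

Let dd : pderiv d = cn * b + cy * d.
Proof.
rewrite /b /d (pderivM ey) pderivD pderivN -pconst1 pderivC add0r.
rewrite (pderivM (cm * cn)) (pderivM cm) !pderivC dey dD1 mulr0 mul0r addr0.
rewrite mul0r add0r -!mulrA n_ey n_m addrC pconst1.
by rewrite !em2CA !mulrN em2CA.
Qed.

Let ey0 : ey 0%N = 1. Proof. exact: pexp0. Qed.
Let eu0 : eu 0%N = 1. Proof. exact: pexp0. Qed.
Let a0 : a 0%N = 1.
Proof.
by rewrite /a pserM0 pserD !pserM0 ey0 eu0 A1E pserD pserN !pserM0 B10 D10
  !(mulr0, mul0r, subr0, addr0, mulr1).
Qed.
Let b0 : b 0%N = 0. Proof. by rewrite /b !pserM0 B10 mulr0. Qed.
Let c0 : c 0%N = 0. Proof. by rewrite /c !pserM0 C10 mulr0. Qed.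
Let d0 : d 0%N = 1.
Proof. by rewrite /d pserM0 pserD pserN !pserM0 D10 ey0 !mulr0 subr0 mulr1. Qed.

Let n_K f g : pbicomm u f -> f * (cn * g) = cn * (f * g).
Proof. by move=> uf; rewrite !mulrA (pbicomm_comm_const comm_nu uf). Qed.
Let m_K f g : pbicomm u f -> f * (cm * g) = cm * (f * g).
Proof. by move=> uf; rewrite !mulrA (pbicomm_comm_const comm_mu uf). Qed.
Let y_K f g : pbicomm u f -> f * (ey * g) = ey * (f * g).
Proof.
move=> uf; rewrite !mulrA; congr (_ * _).
apply: pser_comm => i j; rewrite /ey /pexp; apply/commrZ/commrX/commr_sym.
exact: uf.
Qed.

Let w := cm * cn.
Let w_K f g : pbicomm u f -> f * (w * g) = w * (f * g).
Proof. by move=> uf; rewrite /w -!mulrA m_K // n_K. Qed.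
(** By [A1E] the terms with [eu * D1] cancel, which leaves a multiple of [cm * cn]. *)
Let a_sub_d : a - eu * d = ey * (w * (B1 * C1)).
Proof.
rewrite /a /d -/w (y_K _ biE) mulrBr mulr1 (w_K _ biE) -mulrBr A1E (mulrBr w).
by rewrite opprD addrACA subrr add0r opprK subrK.
Qed.

(** Equivalently, [pexp h2%:A * ((a - eu * d) * d) = b * c]. Once both factors [ey] are moved to the
    front, each side is [em1] times [ey * ey * (cm * cn) * (B1 * C1)]: on the left [cn] also passes
    an [ey], and the resulting [em2] cancels [pexp h2%:A]. *)
Lemma sdet_solution :
  pexp h2%:A * (a * d) - b * c = pexp h2%:A * (eu * (d * d)).
Proof.
apply/eqP; rewrite subr_eq addrC -subr_eq -mulrBr; apply/eqP.
rewrite [eu * _]mulrA -mulrBl a_sub_d /d /b /c -/w -!mulrA.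
(* The term with [D1] dies because [n m n = - m n n = 0]. *)
have tail0 : cn * (B1 * (C1 * (1 - cm * (cn * D1)))) = cn * (B1 * C1).
  rewrite (mulrBr C1) mulr1 (m_K _ biC) (mulrBr B1) (m_K _ biB) (mulrBr cn) n_m.
  by rewrite (n_K _ biC) (n_K _ biB) n_n mulr0 oppr0 subr0.
rewrite (y_K _ biC) !(y_K _ biB) n_ey tail0 em2CA (n_K _ biB) !m_ey !em1CA.
rewrite [ey * (em2 * _)]em2CA (mulrA _ em2) (pexp_scalar_comm h2).
by rewrite em2K mul1r.
Qed.

(** Uniqueness, applied to each column, identifies any solution with the explicit one. *)
Lemma sdet_of_solution (a' b' c' d' : pser A) :
  a' 0%N = 1 -> b' 0%N = 0 -> c' 0%N = 0 -> d' 0%N = 1 ->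
  pderiv a' = cx * a' + cm * c' -> pderiv c' = cn * a' + cy * c' ->
  pderiv b' = cx * b' + cm * d' -> pderiv d' = cn * b' + cy * d' ->
  pexp h2%:A * (a' * d') - b' * c' = pexp h2%:A * (eu * (d' * d')).
Proof.
move=> a'0 b'0 c'0 d'0 da' dc' db' dd'.
have [|| -> ->] := pderiv_system_inj _ _ da' dc' da dc; rewrite ?a0 ?c0 //.
have [|| -> ->] := pderiv_system_inj _ _ db' dd' db dd; rewrite ?b0 ?d0 //.
exact: sdet_solution.
Qed.

End FormalSdet.

(** * The formal exponential of a matrix *)

Section MatrixExp.
Variables (F : numFieldType) (A : algType F).

Definition pmexp k (Z : 'M[A]_k.+1) i j : pser A :=
  fun n => (n`!%:R^-1 : F) *: (Z ^+ n) i j.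

Lemma pmexp0 k (Z : 'M[A]_k.+1) i j : pmexp Z i j 0%N = (i == j)%:R.
Proof. by rewrite /pmexp fact0 invr1 scale1r mxE. Qed.

Lemma pderiv_mexp k (Z : 'M[A]_k.+1) i j :
  pderiv (pmexp Z i j) = \sum_l pconst (Z i l) * pmexp Z l j.
Proof.
apply: pserP => n.
rewrite (big_morph (fun f : pser A => f n) (id1 := 0) (op1 := +%R)) //.
rewrite /pderiv /pmexp scalerMnl factVS exprS mxE scaler_sumr.
by apply: eq_bigr => l _; rewrite pserCM scalerAr.
Qed.

Lemma sdet_formal (Z : 'M[A]_2) (h1 h2 : F) :
  let x := Z 0 0 in let m := Z 0 1 in let n := Z 1 0 in let y := Z 1 1 in
  x * m - m * x = h1 *: m -> y * m - m * y = h1 *: m ->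
  x * n - n * x = h2 *: n -> y * n - n * y = h2 *: n ->
  x * y - y * x = 0 -> m * m = 0 -> n * n = 0 -> m * n + n * m = 0 ->
  pexp h2%:A * (pmexp Z 0 0 * pmexp Z 1 1) - pmexp Z 0 1 * pmexp Z 1 0 =
  pexp h2%:A * (pexp (x - y) * (pmexp Z 1 1 * pmexp Z 1 1)).
Proof.
move=> x m n y xm ym xn yn xy mm nn mn.
have E i j : pderiv (pmexp Z i j) =
    pconst (Z i 0) * pmexp Z 0 j + pconst (Z i 1) * pmexp Z 1 j.
  rewrite pderiv_mexp !big_ord_recl big_ord0 addr0.
  by congr (_ + pconst (Z i _) * pmexp Z _ j); apply: val_inj.
pose u := x - y.
have biE : pbicomm u (pexp u) by exact/pbicomm_exp/bicomm_id.
have biS c : pbicomm u (pexp c%:A : pser A) by exact/pbicomm_exp/bicomm_scalar.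
(* Variation of constants for [B' = u B + e^{-t h1}] with [B(0) = 0]. *)
pose B : pser A := pexp u * pint (pexp (- u) * pexp (- h1)%:A).
have dB : pderiv B = pconst u * B + pexp (- h1)%:A.
  by rewrite pderivM pintK pderiv_exp !mulrA pexpNK mul1r.
have biB : pbicomm u B.
  apply/pbicommM/pbicomm_int/pbicommM => //.
  exact/pbicomm_exp/bicommN/bicomm_id.
pose C : pser A := pint (pexp (- h2)%:A * pexp u).
have biC : pbicomm u C by exact/pbicomm_int/pbicommM.
(* The second [pintK] makes [D1] the primitive of [pexp (- h2)%:A * B] without constant term, and
   [erefl] takes [A1E] as the definition of [A1]. *)
apply: (sdet_of_solution xm ym xn yn xy mm nn mn biB biC dB (pintK _) (pintK _)
  _ _ _ (erefl _)); rewrite ?pmexp0 ?E //.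
by rewrite /B pserM0 mulr0.
Qed.

End MatrixExp.

(** Both sides sum [f i * g j] over the triangle [i + j < n]; the induction step adds the diagonal
    [i + j = n]. *)
Lemma sum_pserM (A : nzRingType) (f g : pser A) n :
  \sum_(0 <= k < n) (f * g) k =
  \sum_(0 <= i < n) f i * \sum_(0 <= j < n - i) g j.
Proof.
elim: n => [|n IHn]; first by rewrite !big_geq.
rewrite big_nat_recr //= IHn pserM.
rewrite -(big_mkord xpredT (fun i => f i * g (n - i)%N)).
rewrite [RHS]big_nat_recr //= subSn // subnn big_nat1.
rewrite [X in _ + X = _]big_nat_recr //= subnn addrA -big_split /=.
congr (_ + _); apply: eq_big_nat => i /andP[_ lin].
by rewrite subSn 1?ltnW // big_nat_recr //= mulrDr.
Qed.

(** * Cauchy products in locally convex algebras *)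

Section RealCauchy.
Variable R : realType.

Lemma cvg0D (f g : nat -> R) : f n @[n --> \oo] --> (0 : R) ->
  g n @[n --> \oo] --> (0 : R) -> f n + g n @[n --> \oo] --> (0 : R).
Proof. by move=> f0 g0; rewrite -[X in _ --> X](addr0 0); exact: cvgD. Qed.

Implicit Types u v : pser R.

Let S u n := \sum_(0 <= k < n) u k.

Lemma partial_sum_ge0 u n : (forall k, 0 <= u k) -> 0 <= S u n.
Proof. by move=> u0; apply: sumr_ge0. Qed.

Lemma partial_sum_homo u : (forall k, 0 <= u k) ->
  {homo S u : m n / (m <= n)%N >-> m <= n}.
Proof. by move=> u0; apply: nondecreasing_series. Qed.

(** The triangle [i + j < n] contains the square of side [n./2] and lies in the square of side
    [n]. *)
Lemma cauchy_partial_le u v n : (forall k, 0 <= u k) -> (forall k, 0 <= v k) ->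
  S u n./2 * S v n./2 <= S (u * v) n <= S u n * S v n.
Proof.
move=> u0 v0; rewrite /S sum_pserM !mulr_suml; apply/andP; split; last first.
  apply: ler_sum => i _; apply: ler_wpM2l => //.
  by apply: (partial_sum_homo v0); exact: leq_subr.
have h_le : (n./2 <= n)%N by lia.
rewrite [leRHS](big_cat_nat (leq0n _) h_le) //=; apply: ler_wpDr.
  by apply: sumr_ge0 => i _; apply: mulr_ge0 => //; exact: partial_sum_ge0.
rewrite big_nat [leRHS]big_nat; apply: ler_sum => i /andP[_ ilt].
apply: ler_wpM2l => //; apply: (partial_sum_homo v0); lia.
Qed.

Lemma half_cvgny : (fun n => n./2) @ \oo --> \oo.
Proof.
apply/cvgnyPge => m; exists m.*2 => // n /= mn.
by rewrite -(doubleK m) half_leq.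
Qed.

Lemma cauchy_product_cvg u v (a b : R) :
  (forall k, 0 <= u k) -> (forall k, 0 <= v k) ->
  S u @ \oo --> a -> S v @ \oo --> b -> S (u * v) @ \oo --> a * b.
Proof.
move=> u0 v0 ua vb.
apply: (@squeeze_cvgr _ _ _ _ (fun n => S u n./2 * S v n./2)
  (fun n => S u n * S v n)).
- by near=> n; exact: cauchy_partial_le.
- by apply: cvgM; apply: (cvg_comp _ _ half_cvgny).
- exact: cvgM.
Unshelve. all: by end_near.
Qed.
End RealCauchy.

Section Seminorms.
Variables (R : realType) (A : unitAlgType R[i]) (I : Type) (N : I -> A -> R).
Hypothesis hN : locally_convex_algebra N.
Implicit Types (i : I) (u v s t : A) (f g : pser A) (J : seq I).

Let ND i u v : N i (u + v) <= N i u + N i v.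
Proof. by case: hN. Qed.
Let NZ i (c : R[i]) u : N i (c *: u) = Normc.normc c * N i u.
Proof. by case: hN. Qed.

Lemma seminorm0 i : N i 0 = 0.
Proof. by rewrite -(scale0r 0) NZ Normc.normc0 mul0r. Qed.

Lemma seminormN i u : N i (- u) = N i u.
Proof. by rewrite -scaleN1r NZ normcN Normc.normc1 mul1r. Qed.

Lemma seminorm_ge0 i u : 0 <= N i u.
Proof.
have := ND i u (- u); rewrite subrr seminorm0 seminormN -mulr2n.
by rewrite pmulrn_lge0.
Qed.

Lemma seminormB i u v : N i (u - v) <= N i u + N i v.
Proof. by rewrite -[N i v]seminormN. Qed.

Lemma seminorm_sum i (r : seq nat) (f : nat -> A) :
  N i (\sum_(k <- r) f k) <= \sum_(k <- r) N i (f k).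
Proof.
elim: r => [|k r IHr]; first by rewrite !big_nil seminorm0.
by rewrite !big_cons; apply: (le_trans (ND _ _ _)); rewrite lerD2l.
Qed.

Let P J u := \sum_(j <- J) N j u.

Let P_ge0 J u : 0 <= P J u.
Proof. by apply: sumr_ge0 => j _; exact: seminorm_ge0. Qed.

(** Replacing the constant by its absolute value keeps the bound, since seminorms are nonnegative,
    and lets inequalities be multiplied by it. *)
Lemma seminormM i : exists J (K : R), 0 <= K /\
  forall u v, N i (u * v) <= K * P J u * P J v.
Proof.
case: hN => _ _ _ /(_ i) [J [K hK]]; exists J, `|K|; split=> // u v.
apply: (le_trans (hK u v)); apply: ler_wpM2r; first exact: P_ge0.
by apply: ler_wpM2r; [exact: P_ge0|exact: ler_norm].
Qed.

Let S f n := \sum_(0 <= k < n) f k.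

(** Comparison with the partial sums shows that every seminorm of [s - t] is zero, and the seminorms
    separate points. *)
Lemma is_asum_unique f s t : is_asum N f s -> is_asum N f t -> s = t.
Proof.
move=> fs ft; apply/subr0_eq; case: hN => _ _ + _; apply=> i.
apply/eqP; rewrite eq_le seminorm_ge0 andbT.
have [_ cs] := fs i; have [_ ct] := ft i.
have cst0 : N i (S f n - s) + N i (S f n - t) @[n --> \oo] --> (0 : R).
  exact: cvg0D.
apply: (ler_cvg_to (f := fun=> N i (s - t)) _ cst0); first exact: cvg_cst.
near=> n; rewrite -[s - t](subrKA (S f n)) -opprB addrC.
by rewrite [leRHS]addrC; exact: seminormB.
Unshelve. all: by end_near.
Qed.

Lemma is_asumB f g s t : is_asum N f s -> is_asum N g t ->
  is_asum N (f - g) (s - t).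
Proof.
move=> fs gt i; have [cf cs] := fs i; have [cg ct] := gt i; split.
  apply: (@series_le_cvg _ _ (fun n => N i (f n) + N i (g n))) => [n|n|n|].
  - exact: seminorm_ge0.
  - by rewrite addr_ge0 ?seminorm_ge0.
  - exact: seminormB.
  - exact: (is_cvg_seriesD cf cg).
apply: (@squeeze_cvgr _ _ _ _ (cst 0)
  (fun n => N i (S f n - s) + N i (S g n - t))).
- near=> n; rewrite seminorm_ge0 /=.
  rewrite (_ : \sum_(0 <= k < n) _ = S f n - S g n); last by rewrite /S -sumrB.
  by rewrite opprD addrACA -opprD; exact: seminormB.
- exact: cvg_cst.
- exact: cvg0D.
Unshelve. all: by end_near.
Qed.

(** Continuity of the product bounds [N i] of each term by [K] times the Cauchy product of the real
    series [phi] and [psi], whose convergence is known. *)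
Lemma is_asumM f g s t : is_asum N f s -> is_asum N g t ->
  is_asum N (f * g) (s * t).
Proof.
move=> fs gt i; have [J [K [K0 NM]]] := seminormM i.
pose phi : pser R := fun n => P J (f n).
pose psi : pser R := fun n => P J (g n).
have phi0 n : 0 <= phi n by exact: P_ge0.
have psi0 n : 0 <= psi n by exact: P_ge0.
have P_series h r : is_asum N h r -> cvgn (series (fun n => P J (h n))).
  move=> hr; rewrite /P; elim: (J) => [|j J' IH].
    rewrite (_ : series _ = cst 0); first exact: is_cvg_cst.
    by apply/funext => n; rewrite /series /= big1 // => k _; rewrite big_nil.
  rewrite (_ : (fun n => _) =
      (fun n => N j (h n)) + (fun n => \sum_(j <- J') N j (h n))).
    by apply: is_cvg_seriesD => //; case: (hr j).
  by apply/funext => n; rewrite big_cons.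
have P_cvg h r : is_asum N h r -> P J (S h n - r) @[n --> \oo] --> (0 : R).
  move=> hr; rewrite /P; elim: (J) => [|j J' IH].
    by under eq_fun do rewrite big_nil; exact: cvg_cst.
  under eq_fun do rewrite big_cons.
  by apply: cvg0D; first by case: (hr j).
have [a phia] : exists a : R, \sum_(0 <= k < n) phi k @[n --> \oo] --> a.
  by apply/cvg_ex; exact: P_series _ _ fs.
have [b psib] : exists b : R, \sum_(0 <= k < n) psi k @[n --> \oo] --> b.
  by apply/cvg_ex; exact: P_series _ _ gt.
have cab := cauchy_product_cvg phi0 psi0 phia psib.
have Nfg k : N i ((f * g) k) <= K * (phi * psi) k.
  rewrite !pserM -!(big_mkord xpredT (fun j => _ j * _ (k - j)%N)).
  apply: (le_trans (seminorm_sum _ _ _)); rewrite mulr_sumr.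
  by apply: ler_sum => j _; rewrite mulrA; exact: NM.
split.
  apply: (@series_le_cvg _ _ (K *: (phi * psi : nat -> R))) => [n|n||].
  - exact: seminorm_ge0.
  - exact: le_trans (seminorm_ge0 _ _) (Nfg n).
  - exact: Nfg.
  - by apply: is_cvg_seriesZ; apply/cvg_ex; exists (a * b).
pose Phi n := \sum_(0 <= k < n) phi k; pose Psi n := \sum_(0 <= k < n) psi k.
(* The first summand bounds the gap between the product of the partial sums and the partial sum of
   the product. The others bound the expansion of [S f n * S g n - s * t] around [s] and [t]. *)
pose rest n := K * (Phi n * Psi n - \sum_(0 <= k < n) (phi * psi) k) +
  (K * P J (S f n - s) * P J (S g n - t) +
  (K * P J (S f n - s) * P J t + K * P J s * P J (S g n - t))).
apply: (@squeeze_cvgr _ _ _ _ (cst 0) rest); last 2 first.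
- exact: cvg_cst.
- have Z : K * (a * b - a * b) +
      (K * 0 * 0 + (K * 0 * P J t + K * P J s * 0)) = 0.
    by rewrite subrr !(mulr0, mul0r, addr0).
  rewrite -[X in _ --> X]Z.
  have cP := P_cvg _ _ fs; have cQ := P_cvg _ _ gt.
  apply: cvgD.
    by apply: cvgM; [exact: cvg_cst|apply: cvgB => //; exact: cvgM].
  apply: cvgD.
    by apply: cvgM; [apply: cvgM; [exact: cvg_cst|exact: cP]|exact: cQ].
  apply: cvgD; apply: cvgM.
  - by apply: cvgM; [exact: cvg_cst|exact: cP].
  - exact: cvg_cst.
  - exact: cvg_cst.
  - exact: cQ.
near=> n; rewrite seminorm_ge0 /= /rest.
have diff : N i (S f n * S g n - \sum_(0 <= k < n) (f * g) k) <=
    K * (Phi n * Psi n - \sum_(0 <= k < n) (phi * psi) k).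
  rewrite !sum_pserM /S /Phi !mulr_suml -!sumrB.
  apply: (le_trans (seminorm_sum _ _ _)); rewrite mulr_sumr.
  apply: ler_sum => j _; rewrite -!mulrBr mulrA.
  (* In row [j], the square of side [n] exceeds the triangle by the indices from [n - j] to [n - 1].
     The same holds for the real series, so the gaps are compared row by row. *)
  have tail (V : zmodType) (h : nat -> V) : \sum_(0 <= k < n) h k -
      \sum_(0 <= k < n - j) h k = \sum_(n - j <= k < n) h k.
    by rewrite (@big_cat_nat _ _ _ (n - j)) ?leq_subr //= addrAC subrr add0r.
  rewrite /Psi !tail; apply: (le_trans (NM _ _)); apply: ler_wpM2l.
    by rewrite mulr_ge0.
  rewrite /psi /P exchange_big /=; apply: ler_sum => l _.
  exact: seminorm_sum.
have -> : \sum_(0 <= k < n) (f * g) k - s * t =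
    - (S f n * S g n - \sum_(0 <= k < n) (f * g) k) +
    ((S f n - s) * (S g n - t) + ((S f n - s) * t + s * (S g n - t))).
  rewrite opprB (addrA ((S f n - s) * _)) -mulrDr subrK mulrBl mulrBr.
  by rewrite !addrA !subrK.
apply: (le_trans (ND _ _ _)); rewrite seminormN; apply: lerD => //.
apply: (le_trans (ND _ _ _)); apply: lerD => //.
by apply: (le_trans (ND _ _ _)); apply: lerD.
Unshelve. all: by end_near.
Qed.

End Seminorms.

(** * The complex exponential series *)

Section ComplexExp.
Variable R : realType.
Implicit Types (x y : R) (z w : R[i]).

Lemma normc_ge0 z : 0 <= Normc.normc z.
Proof. by case: z => a b; exact: sqrtr_ge0. Qed.

Lemma normc_real x : Normc.normc x%:C = `|x|.
Proof. by rewrite /= expr0n addr0 sqrtr_sqr. Qed.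

Lemma normc_le_ReIm (x y : R) : Normc.normc (x +i* y) <= `|x| + `|y|.
Proof.
rewrite -(@ler_pXn2r _ 2) ?nnegrE ?sqrtr_ge0 ?addr_ge0 //=.
rewrite sqr_sqrtr ?addr_ge0 ?sqr_ge0 // sqrrD !real_normK ?num_real //.
by rewrite addrAC lerDl mulrn_wge0 ?mulr_ge0.
Qed.

Lemma complex_sum (a b : nat -> R) n :
  \sum_(0 <= k < n) (a k +i* b k) =
  (\sum_(0 <= k < n) a k) +i* (\sum_(0 <= k < n) b k).
Proof.
elim: n => [|n IHn]; first by rewrite !big_geq.
by rewrite !big_nat_recr //= IHn.
Qed.

Definition cexp_coeff z n : R[i] := n`!%:R^-1 * z ^+ n.

Lemma complexr_nat n : (n%:R : R[i]) = (n%:R : R)%:C.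
Proof. by rewrite rmorph_nat. Qed.

Lemma normc_cexp_coeff z n :
  Normc.normc (cexp_coeff z n) = exp_coeff (Normc.normc z) n.
Proof.
rewrite /cexp_coeff /exp_coeff /= Normc.normcM Normc.normcV complexr_nat.
rewrite normc_real normr_nat mulrC; congr (_ / _).
by elim: n => [|n IHn]; rewrite ?expr0 ?Normc.normc1 // !exprS Normc.normcM IHn.
Qed.

Lemma is_cvg_norm_cexp_coeff z :
  cvgn (series (fun n => Normc.normc (cexp_coeff z n))).
Proof.
under eq_fun do rewrite normc_cexp_coeff.
exact: is_cvg_series_exp_coeff.
Qed.

Lemma cexp_coeff_real x n : cexp_coeff x%:C n = (exp_coeff x n)%:C.
Proof.
rewrite /cexp_coeff /exp_coeff /= complexr_nat.
by rewrite -fmorphV -rmorphXn -rmorphM mulrC.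
Qed.

(** Even powers of [i y] are real and give the cosine terms; odd ones are imaginary and give the
    sine terms. *)
Lemma cexp_coeff_imag y n :
  cexp_coeff (0 +i* y) n = cos_coeff y n +i* sin_coeff y n.
Proof.
have pow_even k : (0 +i* y) ^+ k.*2 = ((-1) ^+ k * y ^+ k.*2)%:C.
  rewrite -muln2 mulnC !exprM -exprMn mulN1r rmorphXn; congr (_ ^+ _).
  by rewrite expr2; simpc; rewrite /real_complex_def.
rewrite /cexp_coeff /cos_coeff /sin_coeff /= complexr_nat -fmorphV.
case: (boolP (odd n)) => on /=; last first.
  rewrite -{2}(even_halfK on) pow_even -rmorphM (even_halfK on).
  by rewrite !mul0r mul1r mulrC.
rewrite !mul0r mul1r.
(* For odd [n] this exhibits [n.-1./2], the exponent of the sign in [sin_coeff]. *)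
have n2 : n = (n.-1./2.*2).+1.
  by rewrite even_halfK; case: (n) on => //= k; rewrite negbK.
rewrite {2}n2 exprS pow_even.
rewrite [in RHS]n2 exprS -n2.
rewrite /real_complex_def; simpc; congr (_ +i* _).
by rewrite [RHS]mulrC [y * (_ * _)]mulrCA.
Qed.

Lemma norm_series_sub_lim (u : nat -> R) : cvgn (series u) ->
  `|series u n - limn (series u)| @[n --> \oo] --> (0 : R).
Proof.
move=> cu; rewrite -[X in _ --> X](@normr0 _ R^o); apply: cvg_norm.
rewrite -[X in _ --> X](subrr (limn (series u))).
by apply: cvgB; last exact: cvg_cst.
Qed.

Lemma cexp_real_cvg x :
  Normc.normc (\sum_(0 <= k < n) cexp_coeff x%:C k - (expR x)%:C)
  @[n --> \oo] --> (0 : R).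
Proof.
under eq_fun do under eq_bigr do rewrite cexp_coeff_real.
under eq_fun do rewrite -rmorph_sum -rmorphB normc_real.
exact: (norm_series_sub_lim (@is_cvg_series_exp_coeff R x)).
Qed.

Lemma cexp_imag_cvg y :
  Normc.normc (\sum_(0 <= k < n) cexp_coeff (0 +i* y) k - (cos y +i* sin y))
  @[n --> \oo] --> (0 : R).
Proof.
under eq_fun do under eq_bigr do rewrite cexp_coeff_imag.
under eq_fun do rewrite complex_sum.
apply: (@squeeze_cvgr _ _ _ _ (cst 0)
  (fun n => `|series (cos_coeff y) n - cos y| +
            `|series (sin_coeff y) n - sin y|)).
- by near=> n; rewrite normc_ge0 /=; exact: normc_le_ReIm.
- exact: cvg_cst.
- apply: cvg0D.
  + rewrite cos.unlock; apply: norm_series_sub_lim.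
    exact: is_cvg_series_cos_coeff.
  + rewrite sin.unlock; apply: norm_series_sub_lim.
    exact: is_cvg_series_sin_coeff.
Unshelve. all: by end_near.
Qed.

Lemma expC_neq0 z : expC z != 0.
Proof.
rewrite /expC eq_complex /= !mulf_eq0 !(gt_eqF (expR_gt0 _)) /=.
apply/negP => /andP[/eqP c0 /eqP s0]; have := cos2Dsin2 (complex.Im z).
by rewrite c0 s0 expr0n addr0 => /eqP; rewrite eq_sym oner_eq0.
Qed.

Lemma expCNM z : expC z * expC (- z) = 1.
Proof.
case: z => a b; rewrite /expC /= expRN cosN sinN.
have e0 : expR a != 0 by rewrite gt_eqF ?expR_gt0.
apply/eqP; rewrite eq_complex /=; apply/andP; split; apply/eqP.
  rewrite mulrN mulrN opprK mulrACA divff // mul1r mulrACA divff // mul1r.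
  by rewrite -!expr2 cos2Dsin2.
by rewrite !mulrN mulrACA [X in _ + X]mulrACA divff // !mul1r mulrC addNr.
Qed.

End ComplexExp.

(** * Exponentials of scalars in the algebra *)

Section ScalarSums.
Variables (R : realType) (A : unitAlgType R[i]) (I : Type) (N : I -> A -> R).
Hypothesis hN : locally_convex_algebra N.
Implicit Types (z w : R[i]).

Lemma pexp_scalarE z : (pexp z%:A : pser A) = fun n => (cexp_coeff z n)%:A.
Proof.
by apply: pserP => n; rewrite /pexp /cexp_coeff -scalerA exprZn expr1n.
Qed.

Lemma is_asum_scalar (u : nat -> R[i]) (l : R[i]) :
  cvgn (series (fun n => Normc.normc (u n))) ->
  Normc.normc (\sum_(0 <= k < n) u k - l) @[n --> \oo] --> (0 : R) ->
  is_asum N (fun n => (u n)%:A) l%:A.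
Proof.
move=> cu ul i; have NZ : forall c : R[i], N i c%:A = N i 1 * Normc.normc c.
  by move=> c; rewrite mulrC; case: hN.
split.
  rewrite (_ : (fun n => _) = N i 1 *: (fun n => Normc.normc (u n) : R)).
    exact: is_cvg_seriesZ.
  by apply/funext => n; rewrite NZ.
under eq_fun do rewrite -scaler_suml -scalerBl NZ.
have := cvgM (cvg_cst (N i 1)) ul; rewrite mulr0; exact.
Qed.

(** Both sides solve [F' = (z + w) F] with [F(0) = 1]. *)
Lemma pexp_scalarD z w : (pexp (z + w)%:A : pser A) = pexp z%:A * pexp w%:A.
Proof.
apply: (@pderiv_linear_inj _ _ (z + w)%:A);
  rewrite ?pserM0 ?pexp0 ?mulr1 ?pderiv_exp //.
rewrite pderivM !pderiv_exp [pexp z%:A * (_ * _)]mulrA -(pconst_scalar_comm w).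
by rewrite -!mulrA -mulrDl -pconstD -scalerDl.
Qed.

(** The series splits as the Cauchy product of those of the real and imaginary parts of [z], whose
    sums are [expR x] and [cos y + i sin y]. *)
Lemma is_asum_expC z : is_asum N (pexp z%:A) (expC z)%:A.
Proof.
case: z => x y.
have -> : (x +i* y)%C = x%:C + (0 +i* y) by rewrite /real_complex_def; simpc.
have -> : expC (x%:C + (0 +i* y)) = (expR x)%:C * (cos y +i* sin y).
  by rewrite /expC /=  addr0 add0r; simpc.
rewrite pexp_scalarD -scalerA -[X in is_asum _ _ X]mulr_algl.
apply: (is_asumM hN).
  rewrite pexp_scalarE; apply: is_asum_scalar; last exact: cexp_real_cvg.
  exact: is_cvg_norm_cexp_coeff.
rewrite pexp_scalarE; apply: is_asum_scalar; last exact: cexp_imag_cvg.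
exact: is_cvg_norm_cexp_coeff.
Qed.

End ScalarSums.

(** * Evaluation at [t = 1] and the superdeterminant *)

Lemma sD_mul_sqr (R : realType) (A : unitAlgType R[i]) (p q : R[i])
    (T : 'M[A]_2) :
  GLpq p q T ->
  p *: (sD T * (T 1 1 * T 1 1)) = p *: (T 0 0 * T 1 1) - T 0 1 * T 1 0.
Proof.
case=> -[_ dU] _ [_ dc] _ _; rewrite /sD mulrBl.
rewrite !mulrA !mulrVK // scalerBr; congr (_ - _).
(* By [dc], [p *: (gamma * d)] equals [d * gamma], and this [d] cancels the remaining [d^-1]. *)
by rewrite -!mulrA 2!scalerAr -dc mulKr.
Qed.

Theorem mainTheorem7 (R : realType) (A : unitAlgType R[i])
    (I : Type) (N : I -> A -> R) (hN : locally_convex_algebra N)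
    (h1 h2 q p h : R[i])
    (hq : q = expC h1) (hp : p = expC h2)
    (hpq1 : p * q != 1) (hpqN1 : p * q != -1)
    (hh : h = (h1 + h2) / 2%:R)
    (T M : 'M[A]_2)
    (hT : GLpq p q T) (hM : calM h h1 h2 M)
    (hexpM : mexp_defined N (cscalemx h M))
    (hTM : T = mexp N (cscalemx h M))
    (hexpU : exp_defined N (h *: (M 0 0 - M 1 1))) :
  sD T = expA N (h *: (M 0 0 - M 1 1)) /\
  expA N (h *: (M 0 0 - M 1 1)) = expA N (h *: str M).
Proof.
split=> //; have h_neq0 : h != 0.
  (* If [h = 0] then [h2 = - h1], whence [p * q = 1]. *)
  apply: contraNneq hpq1 => h0; move/eqP: hh.
  rewrite h0 eq_sym mulf_eq0 invr_eq0 pnatr_eq0 orbF addrC addr_eq0 => /eqP h2E.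
  by rewrite hp hq h2E mulrC expCNM.
have p_neq0 : p != 0 by rewrite hp expC_neq0.
have dU : T 1 1 \is a GRing.unit by case: hT => -[].
set Z := cscalemx h M in hexpM hTM.
have ZE i j : Z i j = h *: M i j by rewrite mxE.
(* Scaling both entries by [h] turns the eigenvalue [c / h] into [c]. *)
have Zbr (c : R[i]) i j k l : bracket (M i j) (M k l) = (c / h) *: M k l ->
    Z i j * Z k l - Z k l * Z i j = c *: Z k l.
  rewrite /bracket => E.
  rewrite !ZE -!scalerAl -!scalerAr -!scalerBr E !scalerA.
  by rewrite -mulrA [h * (c / h)]mulrCA divff // mulr1 mulrC.
have Z0 i j k l : M i j * M k l = 0 -> Z i j * Z k l = 0.
  by move=> E; rewrite !ZE -!scalerAl -!scalerAr E !scaler0.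
case: hM => -[xm ym mm] [xn yn nn] xy mn.
have xy' : Z 0 0 * Z 1 1 - Z 1 1 * Z 0 0 = 0.
  by rewrite !ZE -!scalerAl -!scalerAr -!scalerBr xy !scaler0.
have mn' : Z 0 1 * Z 1 0 + Z 1 0 * Z 0 1 = 0.
  by rewrite !ZE -!scalerAl -!scalerAr -!scalerDr mn !scaler0.
have formal := sdet_formal (Zbr _ _ _ _ _ xm) (Zbr _ _ _ _ _ ym)
  (Zbr _ _ _ _ _ xn) (Zbr _ _ _ _ _ yn) xy' (Z0 _ _ _ _ mm) (Z0 _ _ _ _ nn) mn'.
(* Since [hexpM] provides a sum, [xget] returns one and not its default [0]. *)
have sumT i j : is_asum N (pmexp Z i j) (T i j).
  rewrite hTM mxE (_ : pmexp Z i j = (fun n => mexp_term Z n i j)).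
    exact: xgetPex (hexpM i j).
  by apply/funext => n; rewrite mxE.
have sumU : is_asum N (pexp (Z 0 0 - Z 1 1)) (expA N (h *: (M 0 0 - M 1 1))).
  by rewrite !ZE -scalerBr; exact: xgetPex hexpU.
have sumP := is_asum_expC hN h2; rewrite -hp in sumP.
have sumD := is_asumM hN (sumT 1 1) (sumT 1 1).
have sumL := is_asumM hN sumP (is_asumM hN sumU sumD).
(* [sumL] now concerns the same series as [sumR] below, so uniqueness of sums equates the two
   values. *)
rewrite -formal in sumL.
have sumR := is_asumB hN (is_asumM hN sumP (is_asumM hN (sumT 0 0) (sumT 1 1)))
  (is_asumM hN (sumT 0 1) (sumT 1 0)).
have := is_asum_unique hN sumL sumR.
rewrite !mulr_algl -(sD_mul_sqr hT) => /(scalerI p_neq0).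
by move/(mulIr (unitrX 2 dU))/esym.
Qed.
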